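(* Let $n\geqslant1$, let $\ell=(\ell_1,\dots,\ell_n)$ with all $\ell_j\geqslant1$ integers, let $c=(c_1,\dots,c_n)\in\mathbb C^n$, and let $f\colon\mathbb Z^n_\geqslant\to\mathbb C$ with discrete generating series $F(\xi;\ell;z)=\sum_{x\in\mathbb Z^n_\geqslant}f(x)\xi^xz^{\underline{\ell x}}$. Then $$\Pi\Big[\big(1-\langle c,\xi z^{\underline\ell}\rho^\ell\rangle\big)F(\xi;\ell;z)\Big]=\sum_{x\geqslant I}\Big(\big(1-\langle c,\delta^{-I}\rangle\big)f(x)\Big)\,\xi^xz^{\underline{\ell x}}.$$
   Context: $\mathbb Z_\geqslant$ denotes the non-negative integers. For $x,y\in\mathbb Z^n$, $x\geqslant y$ is meant componentwise; $I=(1,\dots,1)$; $e_j$ is the $j$-th unit vector. Multi-index notation: $\xi^x=\xi_1^{x_1}\cdots\xi_n^{x_n}$, $\ell x=(\ell_1x_1,\dots,\ell_nx_n)$, $z^{\underline x}=z_1^{\underline{x_1}}\cdots z_n^{\underline{x_n}}$, where $t^{\underline k}=t(t-1)\cdots(t-k+1)$ is the falling factorial ($t^{\underline0}=1$). Discrete generating series are formal: power series in $\xi_1,\dots,\xi_n$ whose coefficients are polynomials in $z_1,\dots,z_n$; operators in $z$ act coefficientwise. $\rho_j$ is the backward shift in $z_j$: $\rho_jg(z)=g(z-e_j)$. $\delta_j$ is the forward shift in $x_j$, so $\delta_j^{-1}f(x)=f(x-e_j)$. $\langle c,\xi z^{\underline\ell}\rho^\ell\rangle=c_1\xi_1z_1^{\underline{\ell_1}}\rho_1^{\ell_1}+\cdots+c_n\xi_nz_n^{\underline{\ell_n}}\rho_n^{\ell_n}$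 (shift first, then multiply), and $\langle c,\delta^{-I}\rangle=c_1\delta_1^{-1}+\cdots+c_n\delta_n^{-1}$. Projections: $\pi_jz=(z_1,\dots,z_{j-1},0,z_{j+1},\dots,z_n)$ and $\pi_jF(\xi;\ell;z)=F(\xi;\ell;\pi_jz)$ (substitution $z_j=0$, applied likewise to any formal series of this kind). The combined projection is $\Pi=(1-\pi_1)\circ\cdots\circ(1-\pi_n)$. *)

(* Defs.v *)
From HB Require Import structures.
From mathcomp Require Import all_boot all_order all_algebra.
From mathcomp Require Import functions mpoly.

Set Implicit Arguments.
Unset Strict Implicit.
Unset Printing Implicit Defensive.

Import GRing.Theory.
Local Open Scope ring_scope.

Definition falling (A : pzRingType) (t : A) (k : nat) : A :=
  \prod_(i < k) (t - i%:R).

Section DiscreteGeneratingSeries.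

Variables (K : comNzRingType) (n : nat).

(* Power series in xi_1, ..., xi_n over K[z_1, ..., z_n]: [G x] is the
   coefficient of xi^x.  Addition, opposite and scaling are the pointwise ones
   of the function type. *)
Definition fseries := 'X_{1..n} -> {mpoly K[n]}.

HB.instance Definition _ := GRing.Lmodule.on fseries.

Implicit Types (G : fseries) (f : 'X_{1..n} -> K) (ell x : 'X_{1..n}).
Implicit Types (g : {mpoly K[n]}) (j : 'I_n).

Definition coeffwise (phi : {mpoly K[n]} -> {mpoly K[n]}) G : fseries :=
  fun x => phi (G x).

(* The product xi_j * G, coefficient by coefficient. *)
Definition mul_xi j G : fseries :=
  fun x => if (U_(j) <= x)%MM then G (x - U_(j))%MM else 0.

Definition mnm_scale ell x : 'X_{1..n} := [multinom (ell i * x i)%N | i < n].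

Definition zfalling x : {mpoly K[n]} := \prod_(i < n) falling 'X_i (x i).

Definition rho j g : {mpoly K[n]} :=
  g \mPo [tuple 'X_i - (i == j)%:R | i < n].

Definition pi_z j g : {mpoly K[n]} :=
  g \mPo [tuple if i == j then 0 else 'X_i | i < n].

Definition pi_s j : fseries -> fseries := coeffwise (pi_z j).

Definition bigPi : fseries -> fseries :=
  \big[(fun P Q : fseries -> fseries => P \o Q)/id]_(j < n)
     (fun G => G - pi_s j G).

(* < c, xi z^\underline{ell} rho^ell > *)
Definition xi_z_rho (c : 'I_n -> K) ell G : fseries :=
  \sum_(j < n)
     c j *: mul_xi j (coeffwise (fun g => falling 'X_j (ell j) *
                                          iter (ell j) (rho j) g) G).

(* Subtraction of exponents is truncated, so the value at [x] is only
   meaningful when [0 < x j]. *)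
Definition delta_inv j f : 'X_{1..n} -> K := fun x => f (x - U_(j))%MM.

(* < c, delta^{-I} > *)
Definition c_delta_inv (c : 'I_n -> K) f : 'X_{1..n} -> K :=
  fun x => \sum_(j < n) c j * delta_inv j f x.

Definition allones : 'X_{1..n} := [multinom 1%N | i < n].

(* \sum_{x in P} f(x) xi^x z^\underline{ell x} *)
Definition dgs_on (P : pred 'X_{1..n}) ell f : fseries :=
  fun x => if P x then f x *: zfalling (mnm_scale ell x) else 0.

Definition dgs ell f : fseries := dgs_on xpredT ell f.

End DiscreteGeneratingSeries.

(* Main.v *)
(** Write [(t)_k] for the falling power.  Since [(t)_(a+b) = (t)_a (t-a)_b],
    applying [(z_j)_(ell_j) rho_j^ell_j] to [(z)_(ell (x - e_j))] gives
    [(z)_(ell x)]: the coefficient of [xi^x] inside [Pi] is a scalar multiple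
    of [(z)_(ell x)].  As [pi_j] kills [(z)_(ell x)] when [0 < x_j] and fixes
    it when [x_j = 0], [Pi] keeps exactly the terms with [I <= x]. *)

Require Import Defs.
From mathcomp Require Import all_boot all_order all_algebra.
From mathcomp Require Import boolp functions reals complex mpoly.

Set Implicit Arguments.
Unset Strict Implicit.
Unset Printing Implicit Defensive.

Import GRing.Theory.
Local Open Scope ring_scope.

Lemma falling_rmorph (A B : pzRingType) (phi : {rmorphism A -> B}) t k :
  phi (falling t k) = falling (phi t) k.
Proof.
rewrite /falling rmorph_prod; apply: eq_bigr => i _.
by rewrite rmorphB rmorph_nat.
Qed.

Lemma fallingD (A : pzRingType) (t : A) a b :
  falling t (a + b) = falling t a * falling (t - a%:R) b.
Proof.
rewrite /falling big_split_ord; congr (_ * _); apply: eq_bigr => i _ /=.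
by rewrite natrD opprD addrA.
Qed.

Lemma falling0 (A : pzRingType) (t : A) : falling t 0 = 1.
Proof. exact: big_ord0. Qed.

Lemma falling_0l (A : pzRingType) k : (0 < k)%N -> falling (0 : A) k = 0.
Proof. by case: k => // k _; rewrite /falling big_ord_recl subrr mul0r. Qed.

Section FallingMonomials.

Variables (K : comNzRingType) (n : nat).

Implicit Types (x y ell : 'X_{1..n}) (j : 'I_n).

Lemma zfalling_comp (s : n.-tuple {mpoly K[n]}) x :
  zfalling K x \mPo s = \prod_(i < n) falling (tnth s i) (x i).
Proof.
rewrite /zfalling rmorph_prod; apply: eq_bigr => i _.
by rewrite falling_rmorph /= comp_mpolyXU -tnth_nth.
Qed.

(** [rho j] is a substitution, hence multiplicative, and moves only the variable of index [j]. The
    factor [(i == j) * k] writes the shift uniformly in [i]. *)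
Lemma iter_rho_zfalling j k x :
  iter k (rho j) (zfalling K x) =
  \prod_(i < n) falling ('X_i - ((i == j) * k)%:R) (x i).
Proof.
elim: k => [|k IHk] /=.
  by apply: eq_bigr => i _; rewrite muln0 subr0.
rewrite IHk /rho rmorph_prod; apply: eq_bigr => i _.
rewrite falling_rmorph rmorphB rmorph_nat /= comp_mpolyXU -tnth_nth tnth_mktuple.
by rewrite -addrA -opprD -natrD mulnS.
Qed.

Lemma falling_iter_rho_zfalling ell x j : (0 < x j)%N ->
  falling 'X_j (ell j) *
    iter (ell j) (rho j) (zfalling K (mnm_scale ell (x - U_(j))%MM)) =
  zfalling K (mnm_scale ell x).
Proof.
move=> xj_gt0; rewrite iter_rho_zfalling /zfalling.
rewrite (bigD1 j) // [RHS](bigD1 j) //= mulrA; congr (_ * _).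
  rewrite !mnmE eqxx mul1n -fallingD; congr falling.
  (* Here [0 < x j] is essential: the subtraction in [x j - 1] is truncated. *)
  by rewrite -mulnS subn1 prednK.
apply: eq_bigr => i /negPf ij.
by rewrite !mnmE ij eq_sym ij mul0n subr0 subn0.
Qed.

(** Setting [z_j = 0] turns factor [j] into a falling power of 0, which has first factor 0 if
    [0 < x j] and is the empty product if [x j = 0]. *)
Lemma pi_z_zfalling j x :
  pi_z j (zfalling K x) = if (0 < x j)%N then 0 else zfalling K x.
Proof.
rewrite /pi_z zfalling_comp; case: ltnP => [xj_gt0|].
  by rewrite (bigD1 j) //= tnth_mktuple eqxx falling_0l // mul0r.
rewrite leqn0 => /eqP xj0; apply: eq_bigr => i _; rewrite tnth_mktuple.
by case: eqP => // ->; rewrite xj0 !falling0.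
Qed.

Lemma bigPi_zfalling ell (h : 'X_{1..n} -> K) : (forall j, (0 < ell j)%N) ->
  bigPi (fun x => h x *: zfalling K (mnm_scale ell x)) =
  dgs_on (fun x => (allones n <= x)%MM) ell h.
Proof.
move=> ell_gt0; rewrite /bigPi.
(* Induction over an arbitrary list of indices: each [1 - pi_j] adds the one condition [0 < x j]. *)
have partial (r : seq 'I_n) :
    (\big[(fun P Q : fseries K n -> fseries K n => P \o Q)/id]_(j <- r)
       (fun G => G - pi_s j G))
      (fun x => h x *: zfalling K (mnm_scale ell x)) =
    dgs_on (fun x => all (fun j => 0 < x j)%N r) ell h.
  elim: r => [|j r IHr]; first by rewrite big_nil.
  rewrite big_cons /= IHr; apply/funext => x.
  rewrite /pi_s /coeffwise /dgs_on /=.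
  change ((if all (fun j => 0 < x j)%N r
             then h x *: zfalling K (mnm_scale ell x) else 0) -
    pi_z j (if all (fun j => 0 < x j)%N r
             then h x *: zfalling K (mnm_scale ell x) else 0) =
    if (0 < x j)%N && all (fun j => 0 < x j)%N r
             then h x *: zfalling K (mnm_scale ell x) else 0).
  case: all; last by rewrite andbF /pi_z comp_mpoly0 subrr.
  (* Since [0 < ell j], the exponent [ell j * x j] is positive exactly when [x j] is. *)
  rewrite andbT /pi_z comp_mpolyZ -/(pi_z _ _) pi_z_zfalling mnmE muln_gt0 ell_gt0.
  by case: ltnP => _; rewrite ?scaler0 ?subr0 ?subrr.
rewrite partial; apply/funext => x; rewrite /dgs_on; congr (if _ then _ else _).
apply/allP/mnm_lepP => [x_gt0 j | x_gt0 j _].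
  by rewrite mnmE x_gt0 // mem_index_enum.
by have := x_gt0 j; rewrite mnmE.
Qed.

(** Multiplication by [xi_j] leaves no term with [x j = 0], so the sum runs only over the [j] where
    [delta_inv j f x] is a genuine backward shift. *)
Lemma xi_z_rho_dgs (c : 'I_n -> K) ell (f : 'X_{1..n} -> K) x :
  xi_z_rho c ell (dgs ell f) x =
  (\sum_(j < n | (0 < x j)%N) c j * delta_inv j f x) *:
    zfalling K (mnm_scale ell x).
Proof.
rewrite /xi_z_rho fct_sumE scaler_suml [RHS]big_mkcond; apply: eq_bigr => j _.
change (c j *: mul_xi j (coeffwise (fun g => falling 'X_j (ell j) *
  iter (ell j) (rho j) g) (dgs ell f)) x =
  if (0 < x j)%N then (c j * delta_inv j f x) *: zfalling K (mnm_scale ell x)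
  else 0).
rewrite /mul_xi /coeffwise /dgs /dgs_on /= lep1mP -lt0n.
case: ifP => [xj_gt0|_]; last by rewrite scaler0.
have iter_rhoZ k a g : iter k (rho j) (a *: g) = a *: iter k (rho j) g.
  by elim: k => //= k ->; rewrite /rho comp_mpolyZ.
by rewrite iter_rhoZ -scalerAr falling_iter_rho_zfalling // scalerA.
Qed.

End FallingMonomials.

Theorem theorem4 (R : realType) (n : nat) (hn : (0 < n)%N)
    (ell : 'X_{1..n}) (hell : forall j : 'I_n, (0 < ell j)%N)
    (c : 'I_n -> R[i]) (f : 'X_{1..n} -> R[i]) :
  let F : fseries R[i] n := dgs ell f in
  bigPi (F - xi_z_rho c ell F) =
  dgs_on (fun x => (allones n <= x)%MM) ell
         (fun x => f x - c_delta_inv c f x).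
Proof.
move=> F.
(* The scalar coefficient at every [x], boundary included; it is compared with
   [f x - c_delta_inv c f x] only after [bigPi] has removed the boundary terms. *)
pose h x := f x - \sum_(j < n | (0 < x j)%N) c j * delta_inv j f x.
have -> : F - xi_z_rho c ell F = fun x => h x *: zfalling _ (mnm_scale ell x).
  apply/funext => x; rewrite /h scalerBl -xi_z_rho_dgs; reflexivity.
rewrite bigPi_zfalling //; apply/funext => x; rewrite /dgs_on.
case: ifP => // /mnm_lepP x_gt0; congr (_ *: _); congr (_ - _).
(* For [x] above [allones] the restriction [0 < x j] is vacuous. *)
by apply: eq_bigl => j; have := x_gt0 j; rewrite mnmE.
Qed.
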